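(* Let $a_x>a_y>a_z>0$ be real numbers and let $P_G=(X_G,Y_G,Z_G)\neq(0,0,0)$ be a point of $\mathbb{R}^3$ with $X_G,Y_G,Z_G\ge 0$. Let $$A(t)=(t+a_x^2)^2(t+a_y^2)^2(t+a_z^2)^2-a_x^2X_G^2(t+a_y^2)^2(t+a_z^2)^2-a_y^2Y_G^2(t+a_x^2)^2(t+a_z^2)^2-a_z^2Z_G^2(t+a_x^2)^2(t+a_y^2)^2 .$$ Then: (1) if $P_G$ is outside the reference ellipsoid, then the polynomial $A(t)$ has a unique real positive root; (2) if $P_G$ is inside the reference ellipsoid, then $A(t)$ has no positive real roots; (3) if $P_G$ is on the reference ellipsoid, then $A(t)$ has no positive real roots and furthermore $A(0)=0$.
   Context: The reference ellipsoid is the triaxial ellipsoid $\frac{X^2}{a_x^2}+\frac{Y^2}{a_y^2}+\frac{Z^2}{a_z^2}=1$. The point $P_G$ is outside, on, or inside the reference ellipsoid according to whether $\frac{X_G^2}{a_x^2}+\frac{Y_G^2}{a_y^2}+\frac{Z_G^2}{a_z^2}$ is $>1$, $=1$, or $<1$. The monic sixth degree polynomial $A(t)$ is (up to sign) the numerator of $\frac{a_x^2X_G^2}{(t+a_x^2)^2}+\frac{a_y^2Y_G^2}{(t+a_y^2)^2}+\frac{a_z^2Z_G^2}{(t+a_z^2)^2}-1$ over the common denominator $(t+a_x^2)^2(t+a_y^2)^2(t+a_z^2)^2$. *)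

(* Defs.v *)
From HB Require Import structures.
From mathcomp Require Import all_boot all_order all_algebra.
From mathcomp Require Import reals.

Set Implicit Arguments.
Unset Strict Implicit.
Unset Printing Implicit Defensive.

Import Order.TTheory GRing.Theory Num.Theory.
Local Open Scope ring_scope.

Section Ellipsoid.
Variable R : realType.
Implicit Types ax ay az X Y Z : R.

Definition ellipsoid_form ax ay az X Y Z : R :=
  X ^+ 2 / ax ^+ 2 + Y ^+ 2 / ay ^+ 2 + Z ^+ 2 / az ^+ 2.

Definition outside_ellipsoid ax ay az X Y Z : Prop :=
  1 < ellipsoid_form ax ay az X Y Z.

Definition on_ellipsoid ax ay az X Y Z : Prop :=
  ellipsoid_form ax ay az X Y Z = 1.

Definition inside_ellipsoid ax ay az X Y Z : Prop :=
  ellipsoid_form ax ay az X Y Z < 1.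

Definition polyA ax ay az X Y Z : {poly R} :=
  ('X + (ax ^+ 2)%:P) ^+ 2 * ('X + (ay ^+ 2)%:P) ^+ 2 * ('X + (az ^+ 2)%:P) ^+ 2
  - (ax ^+ 2 * X ^+ 2)%:P * ('X + (ay ^+ 2)%:P) ^+ 2 * ('X + (az ^+ 2)%:P) ^+ 2
  - (ay ^+ 2 * Y ^+ 2)%:P * ('X + (ax ^+ 2)%:P) ^+ 2 * ('X + (az ^+ 2)%:P) ^+ 2
  - (az ^+ 2 * Z ^+ 2)%:P * ('X + (ax ^+ 2)%:P) ^+ 2 * ('X + (ay ^+ 2)%:P) ^+ 2.

End Ellipsoid.

(* Main.v *)
Require Import Defs.
From HB Require Import structures.
From mathcomp Require Import all_boot all_order all_algebra.
From mathcomp Require Import reals.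
From mathcomp Require Import ring lra.

Set Implicit Arguments.
Unset Strict Implicit.
Unset Printing Implicit Defensive.

Import Order.TTheory GRing.Theory Num.Theory.
Local Open Scope ring_scope.

(** Dividing [A(t)] by the product of the [(t + a^2)^2] leaves [1 - F(t)], where
    [F(t)] is the sum of the three terms [a^2 x^2 / (t + a^2)^2] (lemma
    [horner_polyA]), so for [t >= 0], where the product is positive, the sign
    of [A(t)] is that of [1 - F(t)]
    and the roots are the solutions of [F(t) = 1].  As the point is not the
    origin, [F] is strictly decreasing on the nonnegative reals
    ([secular_decr]); it starts at [F(0)], which is the value of the quadratic
    form of the ellipsoid ([secular0]), and eventually drops below [1]
    ([secular_lt1]).  Hence [F] takes the value [1] at most once for [t > 0];
    it never does so if [F(0) <= 1], and it does by the intermediate value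
    theorem for polynomials if [F(0) > 1]. *)

Definition secular_term (R : fieldType) (a x t : R) : R :=
  a ^+ 2 * x ^+ 2 / (t + a ^+ 2) ^+ 2.

Definition secular (R : fieldType) (ax ay az X Y Z t : R) : R :=
  secular_term ax X t + secular_term ay Y t + secular_term az Z t.

Lemma shift_sqr_gt0 (R : realFieldType) (a t : R) :
  0 < a -> 0 <= t -> 0 < t + a ^+ 2.
Proof. by move=> a_gt0 t_ge0; rewrite ltr_wpDl ?exprn_gt0. Qed.

(** Keeping track of the equality case lets the three comparisons be added
    without distinguishing which coordinates of the point vanish. *)
Lemma secular_term_leif (R : realFieldType) (a x s t : R) :
  0 < a -> 0 <= s -> s < t ->
  secular_term a x t <= secular_term a x s ?= iff (x == 0).
Proof.
move=> a_gt0 s_ge0 st; rewrite /secular_term.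
have [->|x_neq0] := eqVneq x 0; first by rewrite expr0n /= mulr0 !mul0r; split; rewrite ?eqxx.
have ps := shift_sqr_gt0 a_gt0 s_ge0.
have pt := shift_sqr_gt0 a_gt0 (ltW (le_lt_trans s_ge0 st)).
have lt_ts : a ^+ 2 * x ^+ 2 / (t + a ^+ 2) ^+ 2
             < a ^+ 2 * x ^+ 2 / (s + a ^+ 2) ^+ 2.
  rewrite ltr_pM2l; last by rewrite -exprMn exprn_even_gt0 //= mulf_neq0 // gt_eqF.
  by rewrite ltf_pV2 ?posrE ?exprn_gt0 // ltr_pXn2r ?ltrD2r // nnegrE ltW.
by split; [exact: ltW | exact: lt_eqF].
Qed.

(** As [t ^+ 2 <= (t + a ^+ 2) ^+ 2]. *)
Lemma secular_term_le (R : realFieldType) (a x t : R) :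
  0 < a -> 0 < t -> secular_term a x t <= a ^+ 2 * x ^+ 2 / t ^+ 2.
Proof.
move=> a_gt0 t_gt0; have pt := shift_sqr_gt0 a_gt0 (ltW t_gt0).
apply: ler_wpM2l; first by rewrite mulr_ge0 ?sqr_ge0.
rewrite lef_pV2 ?posrE ?exprn_gt0 // ler_pXn2r ?nnegrE ?(ltW t_gt0) ?(ltW pt) //.
by rewrite lerDl sqr_ge0.
Qed.

Section Secular.
Variables (R : realType) (ax ay az X Y Z : R).
Hypotheses (ax_gt0 : 0 < ax) (ay_gt0 : 0 < ay) (az_gt0 : 0 < az).

Local Notation F := (secular ax ay az X Y Z).

Lemma secular_decr (s t : R) :
  (X, Y, Z) <> (0, 0, 0) -> 0 <= s -> s < t -> F t < F s.
Proof.
move=> P_neq0 s_ge0 st.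
have leF := leifD (leifD (secular_term_leif X ax_gt0 s_ge0 st)
  (secular_term_leif Y ay_gt0 s_ge0 st)) (secular_term_leif Z az_gt0 s_ge0 st).
rewrite (lt_leif leF); apply/negP => /andP[/andP[/eqP X0 /eqP Y0] /eqP Z0].
by apply: P_neq0; rewrite X0 Y0 Z0.
Qed.

Lemma secular0 : F 0 = ellipsoid_form ax ay az X Y Z.
Proof.
by rewrite /secular /secular_term /ellipsoid_form; field; rewrite !gt_eqF.
Qed.

(** With [S] the sum of the [a ^+ 2 * x ^+ 2], one has [F t <= S / t ^+ 2] and
    [t = 1 + S] is large enough. *)
Lemma secular_lt1 : exists2 t, 0 < t & F t < 1.
Proof.
set S := ax ^+ 2 * X ^+ 2 + ay ^+ 2 * Y ^+ 2 + az ^+ 2 * Z ^+ 2.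
have S_ge0 : 0 <= S by rewrite !addr_ge0 // mulr_ge0 ?sqr_ge0.
have t_gt0 : 0 < 1 + S by rewrite ltr_wpDr.
exists (1 + S) => //.
have le_F : F (1 + S) <= S / (1 + S) ^+ 2.
  by rewrite /S 2!mulrDl; do 2?apply: lerD; exact: secular_term_le.
apply: (le_lt_trans le_F); rewrite ltr_pdivrMr ?exprn_gt0 //; nra.
Qed.

Lemma horner_polyA (t : R) : 0 <= t ->
  (polyA ax ay az X Y Z).[t] =
  (t + ax ^+ 2) ^+ 2 * (t + ay ^+ 2) ^+ 2 * (t + az ^+ 2) ^+ 2 * (1 - F t).
Proof.
move=> t_ge0; rewrite /polyA !hornerE /= /secular /secular_term; field.
by rewrite !gt_eqF ?shift_sqr_gt0.
Qed.

Let prod_gt0 (t : R) : 0 <= t ->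
  0 < (t + ax ^+ 2) ^+ 2 * (t + ay ^+ 2) ^+ 2 * (t + az ^+ 2) ^+ 2.
Proof. by move=> t_ge0; rewrite !mulr_gt0 ?shift_sqr_gt0. Qed.

Lemma root_polyA (t : R) : 0 <= t ->
  root (polyA ax ay az X Y Z) t = (F t == 1).
Proof.
move=> t_ge0; rewrite rootE horner_polyA // mulf_eq0.
by rewrite (gt_eqF (prod_gt0 t_ge0)) subr_eq0 eq_sym.
Qed.

Lemma polyA_le0 (t : R) : 0 <= t ->
  ((polyA ax ay az X Y Z).[t] <= 0) = (1 <= F t).
Proof.
by move=> t_ge0; rewrite horner_polyA // pmulr_rle0 ?prod_gt0 // subr_le0.
Qed.

Lemma polyA_ge0 (t : R) : 0 <= t ->
  (0 <= (polyA ax ay az X Y Z).[t]) = (F t <= 1).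
Proof.
by move=> t_ge0; rewrite horner_polyA // pmulr_rge0 ?prod_gt0 // subr_ge0.
Qed.

Lemma no_pos_root : (X, Y, Z) <> (0, 0, 0) -> F 0 <= 1 ->
  ~ exists t, 0 < t /\ root (polyA ax ay az X Y Z) t.
Proof.
move=> P_neq0 F0_le1 [t [t_gt0]]; rewrite root_polyA ?ltW // => /eqP Ft1.
by have := secular_decr P_neq0 (lexx 0) t_gt0; rewrite Ft1 ltNge F0_le1.
Qed.

Lemma unique_pos_root : (X, Y, Z) <> (0, 0, 0) -> 1 < F 0 ->
  exists! t, 0 < t /\ root (polyA ax ay az X Y Z) t.
Proof.
move=> P_neq0 F0_gt1; have [b b_gt0 Fb] := secular_lt1.
have [|t /andP[t_ge0 _] t_root] :=
    @poly_ivt R (polyA ax ay az X Y Z) 0 b (ltW b_gt0).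
  by rewrite polyA_le0 // polyA_ge0 ?ltW.
have Ft1 : F t = 1 by apply/eqP; rewrite -root_polyA.
exists t; split=> [|u [u_gt0]].
  split=> //; rewrite lt0r t_ge0 andbT.
  by apply: contraTneq F0_gt1 => t0; rewrite -t0 Ft1 ltxx.
rewrite root_polyA ?ltW // => /eqP Fu1.
have [tu|ut|//] := ltgtP t u.
  by have := secular_decr P_neq0 t_ge0 tu; rewrite Ft1 Fu1 ltxx.
by have := secular_decr P_neq0 (ltW u_gt0) ut; rewrite Ft1 Fu1 ltxx.
Qed.

End Secular.

Theorem mainTheorem1 (R : realType) (ax ay az XG YG ZG : R)
  (haxy : ay < ax) (hayz : az < ay) (haz : 0 < az)
  (hP : (XG, YG, ZG) <> (0, 0, 0))
  (hX : 0 <= XG) (hY : 0 <= YG) (hZ : 0 <= ZG) :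
  [/\ outside_ellipsoid ax ay az XG YG ZG ->
        exists! t : R, 0 < t /\ root (polyA ax ay az XG YG ZG) t,
      inside_ellipsoid ax ay az XG YG ZG ->
        ~ exists t : R, 0 < t /\ root (polyA ax ay az XG YG ZG) t
    & on_ellipsoid ax ay az XG YG ZG ->
        (~ exists t : R, 0 < t /\ root (polyA ax ay az XG YG ZG) t) /\
        (polyA ax ay az XG YG ZG).[0] = 0].
Proof.
have hay : 0 < ay := lt_trans haz hayz.
have hax : 0 < ax := lt_trans hay haxy.
rewrite /outside_ellipsoid /inside_ellipsoid /on_ellipsoid -secular0 //.
split=> [F0_gt1|F0_lt1|F0_eq1].
- exact: unique_pos_root.
- by apply: no_pos_root => //; exact: ltW.
- split; first by apply: no_pos_root => //; rewrite F0_eq1.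
  by apply/eqP; rewrite -rootE root_polyA ?F0_eq1.
Qed.
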